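(* Consider the two-way dynamic matching model described in the context, and suppose the matching network satisfies the general position gap (GPG) condition with parameter $\epsilon$. Let $\mathbf{PM}$ denote the probabilistic matching policy described in the context. Then the decisions of $\mathbf{PM}$ at each period depend only on which queues are empty or non-empty (not on their lengths), and there is an absolute constant $C>0$ (independent of $n$, $\lambda$, $r$, $\epsilon$ and $T$) such that for every horizon $T\ge 1$, $$\mathrm{Regret}(\mathbf{PM},T)\le C\, r_{\max}\,\frac{n^{2.5}}{\epsilon}.$$
   Context: Model. There are $n$ agent types $\mathcal A=\{1,\dots,n\}$ and a finite set $\mathcal M$ of match types; each match $m\in\mathcal M$ consists of exactly two distinct agent types and yields a reward $r_m>0$. Let $M\in\{0,1\}^{\mathcal A\times\mathcal M}$ with $M_{im}=1$ iff match $m$ involves type $i$; every type belongs to at least one match. The graph $(\mathcal A,\mathcal M)$ has the types as vertices and the matches as edges; $m(i,j)$ denotes the match containing types $i$ and $j$. Time is discrete, $t=1,2,\dots$; in each period exactly one agent arrives, of type $i$ with probability $\lambda_i>0$, independently across periods, where $\sum_i\lambda_i=1$. $A_i(t)$ is the number of type-$i$ arrivals in periods $1,\dots,t$. In each period the agent first arrives, then the decision maker may perform matches; a match can be performed only if there is a waiting agent of each of its two types, and matched agents leave. A policy is non-anticipative (possibly randomized); $D_m(t)$ is the number of times match $m$ has been performed up to time $t$, and $Q_i(t)$ is the number of type-$i$ agents waiting after period $t$, with $Q(0)=0$. A queue $i$ is truncated if an arriving type-$i$ agent not matched in its arrival period is discarded forever. Regret. $\mathcal R^\Pi(t)=\mathbb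 E[r^\top D(t)]$, $\mathcal R^*(t)=\mathbb E\big[\max\{r^\top y: My\le A(t),\ y\in\mathbb Z_{\ge 0}^{\mathcal M}\}\big]$, and $\mathrm{Regret}(\Pi,T)=\sup_{0\le t\le T}(\mathcal R^*(t)-\mathcal R^\Pi(t))$. GPG. $\mathrm{SPP}(\lambda)$ is the linear program: maximize $r^\top z$ subject to $Mz+s=\lambda$, $z\in\mathbb R^{\mathcal M}_{\ge0}$, $s\in\mathbb R^{n}_{\ge 0}$. The GPG condition holds if $\mathrm{SPP}(\lambda)$ has a non-degenerate optimal basic solution $(z^*,s^* )$ (all $n$ basic variables strictly positive); fix it and let $\epsilon=\min\big(\min_{m:z^*_m>0}z^*_m,\ \min_{i:s^*_i>0}s^*_i\big)$. Let $\mathcal M_+=\{m:z^*_m>0\}$, $\mathcal A_+=\{i:s^*_i>0\}$, $\mathcal A_0=\mathcal A\setminus\mathcal A_+$, $r_{\max}=\max_{m\in\mathcal M_+}r_m$, and let $\mathcal N(j)$ be the set of neighbors of $j$ in the graph $(\mathcal A,\mathcal M_+)$. It is known that for every $\lambda'\in\mathbb R^n_{\ge0}$ with $\|\lambda-\lambda'\|_1\le\epsilon$, $\mathrm{SPP}(\lambda')$ has an optimal solution whose set of nonzero components equals that of $(z^*,s^* )$. Policy $\mathbf{PM}$. At each period $t$, let $\mathcal U_+(t)=\{i:Q_i(t-1)>0\}$. Define $\tilde\lambda_i(t)=\lambda_i+\epsilon/n$ if $i\in\mathcal U_+(t)$ and $\tilde\lambda_i(t)=\lambda_i$ otherwise,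 and let $(\tilde z(t),\tilde s(t))$ be an optimal solution of $\mathrm{SPP}(\tilde\lambda(t))$ with the same nonzero components as $(z^*,s^* )$. When an agent of type $j$ arrives, if $\mathcal N(j)\cap\mathcal U_+(t)\neq\emptyset$ it is matched with an agent of queue $i\in\mathcal N(j)\cap\mathcal U_+(t)$ with probability $\tilde z_{m(i,j)}(t)/\sum_{k\in\mathcal N(j)\cap\mathcal U_+(t)}\tilde z_{m(k,j)}(t)$; otherwise it joins queue $j$ if $j\in\mathcal A_0$ and is discarded if $j\in\mathcal A_+$. Only matches in $\mathcal M_+$ are ever performed. *)

(* Defs.v *)
From HB Require Import structures.
From mathcomp Require Import all_boot all_order all_algebra.
From mathcomp Require Import boolp classical_sets reals exp.

Set Implicit Arguments.
Unset Strict Implicit.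
Unset Printing Implicit Defensive.

Import Order.TTheory GRing.Theory Num.Theory.

Local Open Scope ring_scope.

(* [n] agent types ['I_n] and [K] match types ['I_K].  [ends_inj] makes the
   graph simple, so that at most one match m(i,j) contains two given types. *)
Record network (R : realType) (n K : nat) := Network {
  ends : 'I_K -> {set 'I_n};
  rew : 'cV[R]_K;
  lam : 'cV[R]_n;
  ends_card : forall m, #|ends m| = 2%N;
  ends_inj : injective ends;
  ends_cover : forall i, exists m, i \in ends m;
  rew_gt0 : forall m, 0 < rew m 0;
  lam_gt0 : forall i, 0 < lam i 0;
  lam_sum1 : \sum_i lam i 0 = 1 }.

Section Planning.
Context (R : realType) (n K : nat) (G : network R n K).

Definition incidence : 'M[R]_(n, K) := \matrix_(i, m) (i \in ends G m)%:R.

Definition spp_feasible (b : 'cV[R]_n) (z : 'cV[R]_K) (s : 'cV[R]_n) : Prop :=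
  [/\ incidence *m z + s = b, forall m, 0 <= z m 0 & forall i, 0 <= s i 0].

Definition spp_value (z : 'cV[R]_K) : R := ((rew G)^T *m z) 0 0.

Definition spp_optimal (b : 'cV[R]_n) (z : 'cV[R]_K) (s : 'cV[R]_n) : Prop :=
  spp_feasible b z s /\
  forall z' s', spp_feasible b z' s' -> spp_value z' <= spp_value z.

(* [B] enumerates the basic variables; an invertible [colsub B _] forces [B]
   to be injective. *)
Definition spp_nondegenerate_basic (z : 'cV[R]_K) (s : 'cV[R]_n) : Prop :=
  exists B : 'I_n -> 'I_(K + n),
    [/\ colsub B (row_mx incidence 1%:M) \in unitmx,
        forall k, k \notin codom B -> col_mx z s k 0 = 0
      & forall i, 0 < col_mx z s (B i) 0].

Definition gpg (z : 'cV[R]_K) (s : 'cV[R]_n) : Prop :=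
  spp_optimal (lam G) z s /\ spp_nondegenerate_basic z s.

(* Since lambda sums to 1, all components of a feasible (z, s) are at most 1:
   the default value 1 only matters for a minimum over the empty set. *)
Definition gap (z : 'cV[R]_K) (s : 'cV[R]_n) : R :=
  Num.min (\big[Num.min/1]_(m | 0 < z m 0) z m 0)
          (\big[Num.min/1]_(i | 0 < s i 0) s i 0).

Definition active_matches (z : 'cV[R]_K) : {set 'I_K} := [set m | 0 < z m 0].

Definition surplus_types (s : 'cV[R]_n) : {set 'I_n} := [set i | 0 < s i 0].

Definition rmax (z : 'cV[R]_K) : R :=
  \big[Num.max/0]_(m in active_matches z) rew G m 0.

End Planning.

(* How many times each match is performed within one period. *)
Definition action (K : nat) := {ffun 'I_K -> nat}.

(* Arrival and action of each past period, in chronological order. *)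
Definition history (n K : nat) := seq ('I_n * action K).

Definition action_of_ord (K N : nat) (d : {ffun 'I_K -> 'I_N}) : action K :=
  [ffun m => val (d m)].

Section Dynamics.
Context (R : realType) (n K : nat) (G : network R n K).

(* The i-th entry of M y, for an integer vector y. *)
Definition usage (y : 'I_K -> nat) (i : 'I_n) : nat :=
  (\sum_(m | i \in ends G m) y m)%N.

(* A truncated queue carries no agent over to the next period. *)
Definition queue_step (tr : {set 'I_n}) (q : 'I_n -> nat)
    (e : 'I_n * action K) : 'I_n -> nat :=
  fun i => if i \in tr then 0%N else (q i + (i == e.1) - usage e.2 i)%N.

Definition queue (tr : {set 'I_n}) (h : history n K) : 'I_n -> nat :=
  foldl (queue_step tr) (fun=> 0%N) h.

Definition nonempty_queues (tr : {set 'I_n}) (h : history n K) : {set 'I_n} :=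
  [set i | (0 < queue tr h i)%N].

(* [decide h j d] is the probability of performing [d] after the past [h] and
   the arrival of [j].  At most [(size h).+1] agents are then present, so that
   a feasible action takes its values in ['I_(size h).+2]. *)
Record policy := Policy {
  truncated : {set 'I_n};
  decide : history n K -> 'I_n -> action K -> R;
  decide_ge0 : forall h j d, 0 <= decide h j d;
  decide_sum1 : forall h j,
    \sum_(d : {ffun 'I_K -> 'I_(size h).+2}) decide h j (action_of_ord d) = 1;
  decide_feasible : forall h j d, decide h j d != 0 ->
    forall i, (usage d i <= queue truncated h i + (i == j))%N }.

(* Expectation of [f] applied to the history [k] periods after [h]: in each
   period the arrival has law lambda, independently of the past, and then the
   action has law [decide]. *)
Fixpoint expect (P : policy) (k : nat) (f : history n K -> R)
    (h : history n K) : R :=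
  if k is k'.+1 then
    \sum_(j < n) lam G j 0 *
      \sum_(d : {ffun 'I_K -> 'I_(size h).+2})
        decide P h j (action_of_ord d) *
        expect P k' f (rcons h (j, action_of_ord d))
  else f h.

Definition performed (h : history n K) (m : 'I_K) : nat :=
  (\sum_(e <- h) e.2 m)%N.

Definition collected (h : history n K) : R :=
  \sum_m rew G m 0 * (performed h m)%:R.

Definition policy_reward (P : policy) (t : nat) : R :=
  expect P t collected [::].

(* The feasible set is finite and nonempty: the supremum is a maximum. *)
Definition offline_value (A : 'I_n -> nat) : R :=
  sup [set \sum_m rew G m 0 * (y m)%:R |
       y in [set y : 'I_K -> nat | forall i, (usage y i <= A i)%N]]%classic.

Definition offline_reward (t : nat) : R :=
  \sum_(a : t.-tuple 'I_n)
    (\prod_(u < t) lam G (tnth a u) 0) * offline_value (fun i => count_mem i a).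

Definition regret (P : policy) (T : nat) : R :=
  sup [set offline_reward t - policy_reward P t |
       t in [set t : nat | (t <= T)%N]]%classic.

End Dynamics.

Section ProbabilisticMatching.
Context (R : realType) (n K : nat) (G : network R n K).
Context (z : 'cV[R]_K) (s : 'cV[R]_n).

Definition pm_nonempty (h : history n K) : {set 'I_n} :=
  nonempty_queues G (surplus_types s) h.

Definition perturbed_lam (U : {set 'I_n}) : 'cV[R]_n :=
  \col_i (lam G i 0 + (if i \in U then gap z s / n%:R else 0)).

Definition same_support (z' : 'cV[R]_K) (s' : 'cV[R]_n) : Prop :=
  (forall m, (z' m 0 != 0) = (z m 0 != 0)) /\
  (forall i, (s' i 0 != 0) = (s i 0 != 0)).

(* [zs h] is the solution (z~, s~) used in the period that follows [h]; it is
   chosen freely among those allowed, possibly using the whole of [h]. *)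
Definition pm_solutions (zs : history n K -> 'cV[R]_K * 'cV[R]_n) : Prop :=
  forall h, spp_optimal G (perturbed_lam (pm_nonempty h)) (zs h).1 (zs h).2 /\
            same_support (zs h).1 (zs h).2.

Definition neighbors (j : 'I_n) : {set 'I_n} :=
  [set i | [exists m in active_matches z, ends G m == [set i; j]]].

(* The entry of [z'] at m(i,j). *)
Definition at_match (z' : 'cV[R]_K) (i j : 'I_n) : R :=
  \sum_(m | ends G m == [set i; j]) z' m 0.

(* Performing m(i,j) once. *)
Definition match_action (i j : 'I_n) : action K :=
  [ffun m => nat_of_bool (ends G m == [set i; j])].

Definition no_action : action K := [ffun=> 0%N].

Definition pm_decide (zs : history n K -> 'cV[R]_K * 'cV[R]_n)
    (h : history n K) (j : 'I_n) (d : action K) : R :=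
  let cand := neighbors j :&: pm_nonempty h in
  let z' := (zs h).1 in
  if cand == finset.set0 then (d == no_action)%:R
  else \sum_(i in cand)
         at_match z' i j / (\sum_(k in cand) at_match z' k j) *
         (d == match_action i j)%:R.

Section Wellformed.
Context (zs : history n K -> 'cV[R]_K * 'cV[R]_n) (zsP : pm_solutions zs).

Let at_match_ge0 h i j : 0 <= at_match (zs h).1 i j.
Proof. by have [[[_ z0 _] _] _] := zsP h; apply: sumr_ge0. Qed.

Let at_match_gt0 h i j : i \in neighbors j -> 0 < at_match (zs h).1 i j.
Proof.
have [[[_ z0 _] _] [sz _]] := zsP h.
rewrite inE => /existsP[m /andP[]]; rewrite inE => zm em.
rewrite /at_match (bigD1 m) //= ltr_wpDr ?sumr_ge0 //.
by rewrite lt0r z0 sz gt_eqF.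
Qed.

Lemma pm_decide_ge0 h j d : 0 <= pm_decide zs h j d.
Proof.
rewrite /pm_decide; case: ifP => _; first exact: ler0n.
apply: sumr_ge0 => i _; rewrite mulr_ge0 ?ler0n // divr_ge0 //.
by apply: sumr_ge0.
Qed.

Let sum_indicator N (d0 : action K) : (forall m, d0 m < N.+1)%N ->
  \sum_(d : {ffun 'I_K -> 'I_N.+1}) (action_of_ord d == d0)%:R = 1 :> R.
Proof.
move=> d0N; pose e : {ffun 'I_K -> 'I_N.+1} := [ffun m => inord (d0 m)].
have eE : action_of_ord e = d0.
  by apply/ffunP => m; rewrite !ffunE /= inordK.
rewrite (bigD1 e) //= eE eqxx big1 ?addr0 // => d /negP de.
case: eqP => // dE; case: de; apply/eqP/ffunP => m; apply/val_inj.
by have /ffunP/(_ m) := etrans dE (esym eE); rewrite !ffunE.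
Qed.

Lemma pm_decide_sum1 h j :
  \sum_(d : {ffun 'I_K -> 'I_(size h).+2})
    pm_decide zs h j (action_of_ord d) = 1.
Proof.
rewrite /pm_decide /=.
case: (boolP (_ == finset.set0)) => [_|/finset.set0Pn[i0 i0P]].
  by apply: sum_indicator => m; rewrite ffunE.
rewrite exchange_big /=.
under eq_bigr => i _.
  rewrite -mulr_sumr sum_indicator; last first.
    by move=> m; rewrite ffunE; case: eqP.
  rewrite mulr1; over.
rewrite -mulr_suml divff // gt_eqF // (bigD1 i0) //= ltr_wpDr ?sumr_ge0 //.
by apply: at_match_gt0; case/setIP: i0P.
Qed.

Let usage_match_action i j k :
  (usage G (match_action i j) k <= (k \in [set i; j]))%N.
Proof.
rewrite /usage (eq_bigr (fun m => nat_of_bool (ends G m == [set i; j]))); last first.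
  by move=> m _; rewrite ffunE.
rewrite -big_mkcondr /= sum1_card.
case: (boolP (k \in _)) => kij; last first.
  rewrite leqn0; apply/eqP/eq_card0 => m; apply/negbTE/negP.
  by rewrite unfold_in => /andP[km /eqP em]; rewrite -em km in kij.
apply/card_le1_eqP => m m'; rewrite !unfold_in => /andP[_ /eqP e] /andP[_ /eqP e'].
by apply: (@ends_inj _ _ _ G); rewrite e e'.
Qed.

Lemma pm_decide_feasible h j d : pm_decide zs h j d != 0 ->
  forall k, (usage G d k <= queue G (surplus_types s) h k + (k == j))%N.
Proof.
rewrite /pm_decide; case: ifPn => _ dn0 k.
  have -> : d = no_action.
    by apply/eqP; apply: contraNT dn0 => /negbTE ->.
  by rewrite /usage big1 // => m _; rewrite ffunE.
have [i /setIP[_ iU] dE] : exists2 i, i \in neighbors j :&: pm_nonempty h &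
    d = match_action i j.
  apply/exists2P; apply/not_existsP => H; case/negP: dn0; apply/eqP/big1 => i iP.
  by case: eqP => [dE|_]; [case: (H i) | rewrite mulr0].
rewrite dE (leq_trans (usage_match_action i j k)) // !inE.
have := iU; rewrite !inE; case: (k =P i) => [->|_ _]; last exact: leq_addl.
by move=> q; rewrite (leq_trans _ (leq_addr _ _)).
Qed.

Definition PM : policy G :=
  Policy pm_decide_ge0 pm_decide_sum1 pm_decide_feasible.

End Wellformed.
End ProbabilisticMatching.

(* Main.v *)
Require Import Defs.
From mathcomp Require Import all_boot all_order all_algebra.
From mathcomp Require Import boolp classical_sets reals exp.
From mathcomp Require Import ring lra zify.

Import Order.TTheory GRing.Theory Num.Theory.
Local Open Scope ring_scope.

(* Let y be the dual solution c_B B^-1 of SPP(lambda).  Weak duality for the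
   offline problem and complementary slackness for PM (which only performs
   active matches) bound the regret at time t by the sum over the non-truncated
   types i of y_i E[Q_i(t)], and y_i <= rmax.

   PM keeps the set of nonempty queues independent in the graph of active
   matches.  Hence a nonempty queue i grows at rate at most lambda_i, while its
   neighbours j are empty, so that sum_k z~_m(k,j) <= lambda_j and the queue
   shrinks at rate at least sum_j z~_m(i,j) = lambda_i + eps/n =: mu_i.
   Comparing with the stationary law of the birth-death walk with these rates
   gives P(Q_i(t) >= k) <= (lambda_i/mu_i)^k, so E[Q_i(t)] <= n lambda_i / eps;
   summing over i, the regret is at most rmax n / eps, and n <= n^(5/2).

   The decisions depend only on the nonempty queues because a solution of the
   perturbed program supported in an invertible basis is unique. *)

(** * Expectations along histories *)

Section Expectation.
Context {R : realType} {n K : nat} {G : network R n K} (P : policy G).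
Implicit Types (f g : history n K -> R) (h : history n K).

(** [expect] unfolds at the first period; peeling off the last one instead lets a one-period
    inequality act at the end of a run. *)
Lemma expectSr k f h : expect P k.+1 f h = expect P k (expect P 1 f) h.
Proof.
elim: k h => [//|k IH] h.
rewrite [LHS]/=; apply: eq_bigr => j _; congr (_ * _).
by apply: eq_bigr => d _; congr (_ * _); exact: IH.
Qed.

Lemma expect_linear k a f g h :
  expect P k (fun x => a * f x + g x) h = a * expect P k f h + expect P k g h.
Proof.
elim: k h => [//|k IH] h /=.
rewrite mulr_sumr -big_split; apply: eq_bigr => j _ /=.
rewrite mulrCA -mulrDr; congr (_ * _).
rewrite mulr_sumr -big_split; apply: eq_bigr => d _ /=.
by rewrite IH; ring.
Qed.

Lemma expect_cst k a h : expect P k (fun=> a) h = a.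
Proof.
elim: k h => [//|k IH] h /=.
under eq_bigr => j _.
  under eq_bigr => d _ do rewrite IH.
  rewrite -mulr_suml decide_sum1 mul1r; over.
by rewrite -mulr_suml lam_sum1 mul1r.
Qed.

Lemma expect_sum k I (r : seq I) (Q : pred I) (a : I -> R)
    (f : I -> history n K -> R) h :
  expect P k (fun x => \sum_(i <- r | Q i) a i * f i x) h =
  \sum_(i <- r | Q i) a i * expect P k (f i) h.
Proof.
elim: r => [|i r IH].
  rewrite big_nil -[RHS](expect_cst k 0 h); congr (expect P k _ h).
  by apply/funext => x; rewrite big_nil.
rewrite big_cons -IH; case: ifP => Qi; last first.
  by congr (expect P k _ h); apply/funext => x; rewrite big_cons Qi.
rewrite -expect_linear; congr (expect P k _ h).
by apply/funext => x; rewrite big_cons Qi.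
Qed.

(** Invariance is asked only along actions that can occur, because an action of probability zero may
    be infeasible. *)
Definition stable (I : history n K -> Prop) :=
  forall h j d, I h -> decide P h j d != 0 -> I (rcons h (j, d)).

Lemma ler_expect (I : history n K -> Prop) k f g h : stable I -> I h ->
  (forall x, I x -> size x = (size h + k)%N -> f x <= g x) ->
  expect P k f h <= expect P k g h.
Proof.
move=> Iinv; elim: k h => [|k IH] h Ih fg /=; first by apply: fg; rewrite ?addn0.
apply: ler_sum => j _; apply: ler_wpM2l; first exact/ltW/lam_gt0.
apply: ler_sum => d _; have [->|dn0] := eqVneq (decide P h j (action_of_ord d)) 0.
  by rewrite !mul0r.
apply: ler_wpM2l; first exact: decide_ge0.
apply: IH; first exact: Iinv.
by move=> x Ix; rewrite size_rcons addSnnS; apply: fg.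
Qed.

Lemma expect_le_cst (I : history n K -> Prop) k f a h : stable I -> I h ->
  (forall x, I x -> f x <= a) -> expect P k f h <= a.
Proof.
move=> Iinv Ih fa; apply: le_trans (ler_expect I k f (fun=> a) h Iinv Ih _) _.
  by move=> x Ix _; apply: fa.
by rewrite expect_cst.
Qed.

Definition arrivals h (i : 'I_n) : nat := count (fun e => e.1 == i) h.

Lemma expect_arrivals k i h :
  expect P k (fun x => (arrivals x i)%:R) h =
  (arrivals h i)%:R + k%:R * lam G i 0.
Proof.
elim: k h => [|k IH] h /=; first by rewrite mul0r addr0.
under eq_bigr => j _.
  under eq_bigr => d _.
    rewrite IH /arrivals -cats1 count_cat /= addn0; over.
  rewrite -mulr_suml decide_sum1 mul1r natrD -addrA (addrC (j == i)%:R) addrA.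
  rewrite mulrDr; over.
rewrite big_split /= -mulr_suml lam_sum1 mul1r (bigD1 i) //= eqxx mulr1.
rewrite big1 ?addr0; last by move=> j /negbTE ->; rewrite mulr0.
by rewrite -natr1; ring.
Qed.

(* The hypothesis on [q] says that it is dominated by the reflected random walk
   with up rate [a] and down rate [b], whose stationary law is geometric. *)
Lemma geometric_tail (I : history n K -> Prop) (q : history n K -> nat) (a b : R) :
  stable I -> 0 <= a -> a < b -> a + b <= 1 ->
  (forall h k, I h -> (0 < k)%N ->
    expect P 1 (fun x => (k <= q x)%N%:R) h <=
    (1 - a - b) * (k <= q h)%N%:R + (a * (k.-1 <= q h)%N%:R
    + b * (k.+1 <= q h)%N%:R)) ->
  forall t k h, I h -> q h = 0%N ->
  expect P t (fun x => (k <= q x)%N%:R) h <= (a / b) ^+ k.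
Proof.
move=> Iinv a0 ab ab1 step; have b0 : 0 < b by apply: le_lt_trans ab.
elim=> [|t IH] k h Ih q0.
  by rewrite /= q0; case: k => [|k]; rewrite ?expr0 //= exprn_ge0 // divr_ge0 // ltW.
case: k => [|k].
  by rewrite expr0; apply: expect_le_cst Iinv Ih _.
rewrite expectSr.
apply: le_trans (ler_expect I t _ _ h Iinv Ih
  (fun x Ix _ => step x k.+1 Ix (ltn0Sn k))) _ => /=.
rewrite expect_linear expect_linear.
have -> : expect P t (fun x => b * (k.+2 <= q x)%N%:R) h =
    b * expect P t (fun x => (k.+2 <= q x)%N%:R) h.
  rewrite -[RHS]addr0 -[X in _ + X](expect_cst t 0 h) -expect_linear.
  by congr (expect P t _ h); apply/funext => x; rewrite addr0.
(* All three weights are nonnegative, so the induction hypothesis applies at levels k, k+1 and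
   k+2. *)
have ab0 : 0 <= 1 - a - b by lra.
have H1 := ler_wpM2l ab0 (IH k.+1 h Ih q0).
have H2 := ler_wpM2l a0 (IH k h Ih q0).
have H3 := ler_wpM2l (ltW b0) (IH k.+2 h Ih q0).
apply: le_trans (lerD H1 (lerD H2 H3)) _.
(* Stationarity: with rho = a/b, the relation b rho = a makes the weighted sum of rho^(k+1), rho^k
   and rho^(k+2) equal to rho^(k+1). *)
rewrite le_eqVlt; apply/orP; left; apply/eqP.
rewrite !exprS; move: (_ ^+ k) => e; field.
by rewrite gt_eqF.
Qed.

(** The expectation is a sum of tail probabilities, and for rho = a/b the geometric series sums to
    rho/(1-rho) = a/(b-a). *)
Lemma expect_le_geometric (I : history n K -> Prop) (q : history n K -> nat) (a b : R) :
  stable I -> 0 <= a -> a < b -> a + b <= 1 ->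
  (forall h k, I h -> (0 < k)%N ->
    expect P 1 (fun x => (k <= q x)%N%:R) h <=
    (1 - a - b) * (k <= q h)%N%:R + (a * (k.-1 <= q h)%N%:R
    + b * (k.+1 <= q h)%N%:R)) ->
  (forall h, I h -> (q h <= size h)%N) -> I [::] ->
  forall t, expect P t (fun x => (q x)%:R) [::] <= a / (b - a).
Proof.
move=> Iinv a0 ab ab1 step qs I0 t.
have b0 : 0 < b by apply: le_lt_trans ab.
(* After t periods [q] is at most t, so t tails suffice. *)
apply: (@le_trans _ _ (\sum_(k < t) 1 * expect P t (fun x => (k.+1 <= q x)%N%:R) [::])).
  rewrite -expect_sum; apply: ler_expect Iinv I0 _ => x Ix; rewrite add0n => sx.
  under eq_bigr do rewrite mul1r.
  rewrite -natr_sum ler_nat.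
  have qt : (q x <= t)%N by rewrite -sx qs.
  have -> : (\sum_(k < t) (k < q x))%N = minn t (q x).
    by elim: t {sx qt} => [|t IH]; rewrite ?big_ord0 ?min0n // big_ord_recr /= IH; lia.
  by rewrite leq_min qt leqnn.
have -> : a / (b - a) = (a / b) / (1 - a / b).
  by field; rewrite !gt_eqF // ?subr_gt0.
have r0 : 0 <= a / b by rewrite divr_ge0 // ltW.
have r1 : 0 < 1 - a / b by rewrite subr_gt0 ltr_pdivrMr // mul1r.
rewrite ler_pdivlMr //.
apply: (@le_trans _ _ ((\sum_(k < t) (a / b) ^+ k.+1) * (1 - a / b))).
  apply: ler_wpM2r; first exact: ltW.
  apply: ler_sum => k _; rewrite mul1r.
  apply: (geometric_tail I) => //.
  by apply/eqP; rewrite -leqn0 -[leqRHS]/(size (@nil ('I_n * action K))) qs.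
under eq_bigr do rewrite exprS.
rewrite -mulr_sumr -mulrA -[leRHS]mulr1 ler_wpM2l //.
have -> : (\sum_(k < t) (a / b) ^+ k) * (1 - a / b) = 1 - (a / b) ^+ t.
  by rewrite -[RHS]opprB subrX1; ring.
by rewrite gerBl exprn_ge0.
Qed.
End Expectation.

(** * Bases and duality *)

Section Basis.
Context {R : realType} {n N : nat} {A : 'M[R]_(n, N)} {B : 'I_n -> 'I_N}.
Hypothesis B_unit : colsub B A \in unitmx.

(** Extension by zero of a vector of basic coordinates. Summing over [i] makes [dot_spread] hold
    without injectivity of [B]. *)
Definition spread (w : 'cV[R]_n) : 'cV[R]_N := \col_l \sum_i w i 0 * (B i == l)%:R.

Lemma dot_spread (c : 'rV[R]_N) w : c *m spread w = colsub B c *m w.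
Proof.
apply/matrixP => a b; rewrite !mxE (ord1 b).
under eq_bigr do rewrite mxE mulr_sumr.
rewrite exchange_big; apply: eq_bigr => i _ /=.
rewrite (bigD1 (B i)) //= eqxx mulr1 big1 ?addr0 ?mxE // => l /negbTE lB.
by rewrite eq_sym lB !mulr0.
Qed.

Lemma mul_spread w : A *m spread w = colsub B A *m w.
Proof.
apply/row_matrixP => i; rewrite !row_mul dot_spread.
by congr (_ *m _); apply/rowP => j; rewrite !mxE.
Qed.

Lemma basis_injective : injective B.
Proof.
move=> i j Bij; apply/eqP; apply: contraT => ij.
have := B_unit; rewrite -unitmx_tr unitmxE (determinant_alternate ij) ?unitr0 //.
by move=> l; rewrite !mxE Bij.
Qed.

Lemma basis_solution_unique (x y : 'cV[R]_N) :
  (forall k, k \notin codom B -> x k 0 = 0) ->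
  (forall k, k \notin codom B -> y k 0 = 0) ->
  A *m x = A *m y -> x = y.
Proof.
move=> xB yB Axy.
have spreadE (u : 'cV[R]_N) : (forall k, k \notin codom B -> u k 0 = 0) ->
    u = spread (rowsub B u).
  move=> uB; apply/colP => l; rewrite mxE.
  have [/codomP[i ->]|lB] := boolP (l \in codom B).
    rewrite (bigD1 i) //= eqxx mulr1 !mxE big1 ?addr0 // => j.
    by rewrite (inj_eq basis_injective) => /negbTE ->; rewrite mulr0.
  rewrite uB // big1 // => i _; case: eqP => [Bi|_]; last by rewrite mulr0.
  by rewrite -Bi codom_f in lB.
move: Axy; rewrite (spreadE _ xB) (spreadE _ yB) !mul_spread.
by move/(can_inj (mulKmx B_unit)) => ->.
Qed.

(* The multipliers are [c_B B^-1].  A positive reduced cost in column [k] would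
   make moving along the [k]-th edge direction profitable, and nondegeneracy
   leaves room for a small step in that direction. *)
Lemma nondegenerate_dual (c : 'rV[R]_N) (x : 'cV[R]_N) :
  (forall k, k \notin codom B -> x k 0 = 0) ->
  (forall i, 0 < x (B i) 0) ->
  (forall x' : 'cV[R]_N, A *m x' = A *m x -> (forall k, 0 <= x' k 0) ->
    (c *m x') 0 0 <= (c *m x) 0 0) ->
  exists y : 'rV[R]_n,
    (forall k, c 0 k <= (y *m A) 0 k) /\
    (forall k, 0 < x k 0 -> c 0 k = (y *m A) 0 k).
Proof.
move=> xB xpos xopt; pose C := colsub B A.
pose y : 'rV[R]_n := colsub B c *m invmx C; exists y.
have yC : y *m C = colsub B c by rewrite mulmxKV.
split=> [k|k xk]; last first.
  have /codomP[i ->] : k \in codom B.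
    by apply: contraLR xk => /xB ->; rewrite ltxx.
  have /rowP/(_ i) := yC; rewrite !mxE => <-.
  by apply: eq_bigr => l _; rewrite !mxE.
rewrite leNgt; apply/negP => cy.
pose w := invmx C *m col k A.
(* The edge direction: variable [k] rises by one and the basic variables compensate, so [A *m x] is
   unchanged. *)
pose v := delta_mx k 0 - spread w.
have Av : A *m v = 0.
  by rewrite mulmxBr mul_spread mulmxA mulmxV // mul1mx -colE subrr.
have cv : 0 < (c *m v) 0 0.
  rewrite mulmxBr dot_spread mulmxA -/y -colE mxE [X in _ + X]mxE [X in X - _]mxE subr_gt0.
  apply: le_lt_trans cy; rewrite le_eqVlt; apply/orP; left; apply/eqP.
  by rewrite !mxE; apply: eq_bigr => l _; rewrite [col _ _ _ _]mxE.
(* This step satisfies e |v_l| <= x_l on the basis. Off the basis x_l = 0, and the quotient is 0 by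
   convention. *)
pose e := (1 + \sum_l `|v l 0| / x l 0)^-1.
have x0 l : 0 <= x l 0.
  by have [/codomP[i ->]|/xB ->//] := boolP (l \in codom B); exact: ltW.
have q0 l : 0 <= `|v l 0| / x l 0 by rewrite divr_ge0.
have e0 : 0 < e by rewrite invr_gt0 ltr_pwDl // sumr_ge0.
have : (c *m (x + e *: v)) 0 0 <= (c *m x) 0 0.
  apply: xopt => [|l]; first by rewrite mulmxDr -scalemxAr Av scaler0 addr0.
  rewrite mxE [X in _ + X]mxE.
  (* Off the basis [spread w] vanishes, so [v] has only the nonnegative entries of [delta_mx]
     there. *)
  have [/codomP[i ->]|lB] := boolP (l \in codom B); last first.
    rewrite xB // add0r mulr_ge0 ?(ltW e0) // !mxE big1 ?subr0 ?ler0n // => i _.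
    by case: eqP => [Bi|_]; [rewrite -Bi codom_f in lB | rewrite mulr0].
  have : e * `|v (B i) 0| <= x (B i) 0.
    rewrite -ler_pdivlMl // invrK mulrC -ler_pdivrMl // mulrC (bigD1 (B i)) //=.
    by rewrite addrCA lerDl addr_ge0 // sumr_ge0.
  have := ler_norm (- v (B i) 0); rewrite normrN => vn xv.
  have := ler_wpM2l (ltW e0) vn; lra.
rewrite mulmxDr -scalemxAr mxE [X in _ + X]mxE gerDl leNgt => /negP; apply.
exact: mulr_gt0.
Qed.

End Basis.

(** * Consequences of the general position gap condition *)

Section Gpg.
Context {R : realType} {n K : nat} {G : network R n K}.
Context {z : 'cV[R]_K} {s : 'cV[R]_n} (hgpg : gpg G z s).

Lemma incidence_mulE (z' : 'cV[R]_K) i :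
  (incidence G *m z') i 0 = \sum_(m | i \in ends G m) z' m 0.
Proof.
rewrite mxE [RHS]big_mkcond; apply: eq_bigr => m _; rewrite mxE.
by case: (i \in ends G m); rewrite ?mul1r ?mul0r.
Qed.

Lemma mul_row_incidence (z' : 'cV[R]_K) (s' : 'cV[R]_n) :
  row_mx (incidence G) 1%:M *m col_mx z' s' = incidence G *m z' + s'.
Proof. by rewrite mul_row_col mul1mx. Qed.

(** Both solutions vanish outside the basis of (z, s), and an invertible basis determines its
    coordinates. *)
Lemma same_support_unique b (z1 z2 : 'cV[R]_K) (s1 s2 : 'cV[R]_n) :
  spp_feasible G b z1 s1 -> same_support z s z1 s1 ->
  spp_feasible G b z2 s2 -> same_support z s z2 s2 -> z1 = z2.
Proof.
move=> [e1 _ _] ss1 [e2 _ _] ss2; have [_ [B [Bu xB _]]] := hgpg.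
have out z' s' : same_support z s z' s' ->
    forall k, k \notin codom B -> col_mx z' s' k 0 = 0.
  move=> [sz ss] k /xB; case: (splitP k) => j kj.
    have -> : k = lshift n j by apply/val_inj.
    rewrite !col_mxEu => zj; apply/eqP; have := sz j.
    by rewrite zj eqxx => /negbFE.
  have -> : k = rshift K j by apply/val_inj.
  rewrite !col_mxEd => sj; apply/eqP; have := ss j.
  by rewrite sj eqxx => /negbFE.
have : col_mx z1 s1 = col_mx z2 s2.
  apply: (basis_solution_unique Bu); [exact: out|exact: out|].
  by rewrite !mul_row_incidence e1 e2.
by case/eq_col_mx.
Qed.

(** [nondegenerate_dual] for the matrix [M I] with zero cost on slacks: slack columns give the first
    two properties, match columns the last two. *)
Lemma gpg_dual : exists y : 'I_n -> R,
  [/\ forall i, 0 <= y i,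
      forall i, 0 < s i 0 -> y i = 0,
      forall m, rew G m 0 <= \sum_(i in ends G m) y i
    & forall m, 0 < z m 0 -> rew G m 0 = \sum_(i in ends G m) y i].
Proof.
have [[[zs1 z0 s0] opt] [B [Bu xB xpos]]] := hgpg.
have [||x' Ax' x'0|y [yle yeq]] := @nondegenerate_dual _ _ _ _ _ Bu
   (row_mx (rew G)^T 0) (col_mx z s) => //.
  rewrite -(vsubmxK x') !mul_row_col !mul0mx !addr0.
  apply: (opt _ (dsubmx x')); split => [|m|i].
  - by rewrite -mul_row_incidence vsubmxK Ax' mul_row_incidence.
  - by rewrite mxE.
  - by rewrite mxE.
have yz m : (y *m row_mx (incidence G) 1%:M) 0 (lshift n m) = \sum_(i in ends G m) y 0 i.
  rewrite mul_mx_row row_mxEl mxE [RHS]big_mkcond; apply: eq_bigr => i _.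
  by rewrite mxE; case: (i \in ends G m); rewrite ?mulr1 ?mulr0.
have ys i : (y *m row_mx (incidence G) 1%:M) 0 (rshift K i) = y 0 i.
  by rewrite mul_mx_row row_mxEr mulmx1.
exists (y 0); split=> [i|i si|m|m zm].
- by have := yle (rshift K i); rewrite ys row_mxEr mxE.
- by have := yeq (rshift K i); rewrite ys row_mxEr col_mxEd mxE => /(_ si).
- by have := yle (lshift n m); rewrite yz row_mxEl mxE.
- by have := yeq (lshift n m); rewrite yz row_mxEl col_mxEu mxE => /(_ zm).
Qed.

Lemma rmax_ge0 : 0 <= rmax G z.
Proof. exact: bigmax_ge_id. Qed.

(** A type without surplus must use its positive rate in some active match, whose reward is the sum
    of two nonnegative multipliers. *)
Lemma dual_le_rmax (y : 'I_n -> R) i :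
  (forall i, 0 <= y i) ->
  (forall m, 0 < z m 0 -> rew G m 0 = \sum_(i in ends G m) y i) ->
  i \notin surplus_types s -> y i <= rmax G z.
Proof.
move=> y0 yz; rewrite inE => si; have [[[zs1 z0 s0] _] _] := hgpg.
have [m /andP[im zm]] : exists m, (i \in ends G m) && (0 < z m 0).
  apply/existsP; apply: contraNT si => /existsPn H.
  suff -> : s i 0 = lam G i 0 by apply: lam_gt0.
  rewrite -zs1 mxE incidence_mulE big1 ?add0r // => m im.
  by apply/eqP; have := H m; rewrite im /= lt0r z0 andbT negbK.
apply: (@le_trans _ _ (rew G m 0)).
  by rewrite yz // (bigD1 i) //= lerDl sumr_ge0.
by apply: (le_bigmax_cond 0 (fun m => rew G m 0)); rewrite inE.
Qed.

Lemma gap_gt0 : 0 < gap z s.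
Proof. by rewrite /gap lt_min; apply/andP; split; apply: lt_bigmin. Qed.

End Gpg.

(** * Matches and the offline benchmark *)

Section Matches.
Context {R : realType} {n K : nat} {G : network R n K}.

Lemma ends_pairE m i : i \in ends G m ->
  exists k, forall j, (ends G m == [set i; j]) = (j == k).
Proof.
move=> im; have /cards1P[k mk] : #|ends G m :\ i| == 1%N.
  by have := cardsD1 i (ends G m); rewrite im ends_card add1n => -[<-].
exists k => j; apply/eqP/eqP => [mij|->]; last by rewrite -mk finset.setD1K.
have ij : i \notin [set j].
  apply/negP; rewrite inE => /eqP ij; have := ends_card G m.
  by rewrite mij ij finset.setUid cards1.
by move: mk; rewrite mij finset.setU1K // => /finset.set1_inj.
Qed.

(** Each match containing [i] is counted for exactly one [j], its other end. *)
Lemma sum_at_match (z' : 'cV[R]_K) i :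
  \sum_j at_match G z' i j = (incidence G *m z') i 0.
Proof.
rewrite incidence_mulE [RHS]big_mkcond.
under [LHS]eq_bigr => j _ do rewrite /at_match big_mkcond /=.
rewrite exchange_big; apply: eq_bigr => m _ /=; case: ifPn => im.
  have [k mk] := ends_pairE m i im.
  by under eq_bigr do rewrite mk; rewrite -big_mkcond big_pred1_eq.
rewrite big1 // => j _; case: eqP => // mij.
by rewrite mij !inE eqxx in im.
Qed.

Lemma at_matchC (z' : 'cV[R]_K) i j : at_match G z' i j = at_match G z' j i.
Proof. by rewrite /at_match finset.setUC. Qed.

Lemma neighborsC (z : 'cV[R]_K) i j : (i \in neighbors G z j) = (j \in neighbors G z i).
Proof. by rewrite !inE finset.setUC. Qed.

Lemma neighbors_irrefl (z : 'cV[R]_K) i : i \notin neighbors G z i.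
Proof.
rewrite inE; apply/negP => /existsP[m /andP[_ /eqP mi]].
by have := ends_card G m; rewrite mi finset.setUid cards1.
Qed.

Lemma usage_no_action i : usage G (no_action K) i = 0%N.
Proof. by rewrite /usage big1 // => m _; rewrite ffunE. Qed.

(** Being neighbors ensures that the match exists; without a match, [match_action] would be zero. *)
Lemma usage_match_action (z : 'cV[R]_K) i j k : i \in neighbors G z j ->
  usage G (match_action G i j) k = (k \in [set i; j]).
Proof.
rewrite inE => /existsP[m0 /andP[_ /eqP m0E]].
rewrite /usage; under eq_bigr do rewrite ffunE -m0E (inj_eq (@ends_inj _ _ _ G)).
rewrite -m0E big_mkcond (bigD1 m0) //= eqxx big1 => [|m /negbTE ->]; last by case: ifP.
by rewrite addn0; case: ifP.
Qed.

Lemma usageD (y y' : 'I_K -> nat) i :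
  usage G (fun m => y m + y' m)%N i = (usage G y i + usage G y' i)%N.
Proof. exact: big_split. Qed.

Lemma sum_usage (y : 'I_n -> R) (d : 'I_K -> nat) :
  \sum_m (\sum_(i in ends G m) y i) * (d m)%:R = \sum_i y i * (usage G d i)%:R.
Proof.
under eq_bigr do rewrite mulr_suml big_mkcond.
rewrite exchange_big; apply: eq_bigr => i _; rewrite natr_sum mulr_sumr.
by rewrite [RHS]big_mkcond.
Qed.

Lemma performed_rcons h (e : 'I_n * action K) m :
  performed (rcons h e) m = (performed h m + e.2 m)%N.
Proof. by rewrite /performed -cats1 big_cat big_seq1. Qed.

End Matches.

(** * Law of the arrivals and weak duality for the offline benchmark *)

Section Tuples.
Context {R : realType} {n K : nat} {G : network R n K}.

Lemma big_tuple_cons t (F : t.+1.-tuple 'I_n -> R) :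
  \sum_a F a = \sum_j \sum_(a : t.-tuple 'I_n) F [tuple of j :: a].
Proof.
rewrite pair_bigA (reindex (fun p : 'I_n * t.-tuple 'I_n => [tuple of p.1 :: p.2])) //=.
exists (fun a => (thead a, [tuple of behead a])) => [[j a] _|a _].
  by congr pair; apply/val_inj.
by rewrite /= -tuple_eta.
Qed.

Lemma sum_arrival_law t :
  \sum_(a : t.-tuple 'I_n) \prod_(u < t) lam G (tnth a u) 0 = 1.
Proof.
elim: t => [|t IH].
  rewrite (bigD1 [tuple]) //= big_ord0 big1 ?addr0 // => a.
  by rewrite (tuple0 a) => /eqP.
rewrite big_tuple_cons.
under eq_bigr => j _.
  under eq_bigr => a _.
    rewrite big_ord_recl (_ : tnth _ ord0 = j) //.
    under eq_bigr => u _ do rewrite tnthS.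
    over.
  rewrite -mulr_sumr IH mulr1; over.
exact: lam_sum1.
Qed.

Lemma sum_arrival_count t i :
  \sum_(a : t.-tuple 'I_n) (\prod_(u < t) lam G (tnth a u) 0) * (count_mem i a)%:R =
  t%:R * lam G i 0.
Proof.
elim: t => [|t IH].
  by rewrite mul0r big1 // => a _; rewrite (tuple0 a) mulr0.
rewrite big_tuple_cons.
under eq_bigr => j _.
  under eq_bigr => a _.
    rewrite big_ord_recl (_ : tnth _ ord0 = j) //.
    under eq_bigr => u _ do rewrite tnthS.
    rewrite /= natrD -mulrA mulrDr; over.
  rewrite -mulr_sumr big_split /= -mulr_suml sum_arrival_law mul1r IH; over.
under eq_bigr do rewrite mulrDr.
rewrite big_split /= -mulr_suml lam_sum1 mul1r (bigD1 i) //= eqxx mulr1.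
rewrite big1 => [|j /negbTE ->]; last by rewrite mulr0.
by rewrite addr0 -natr1; ring.
Qed.

(** Weak duality: price each match at the sum of the multipliers of its ends, then exchange the
    sums. *)
Lemma offline_value_le (y : 'I_n -> R) (A : 'I_n -> nat) :
  (forall i, 0 <= y i) ->
  (forall m, rew G m 0 <= \sum_(i in ends G m) y i) ->
  offline_value G A <= \sum_i y i * (A i)%:R.
Proof.
move=> y0 yr; apply: ge_sup.
  exists (\sum_m rew G m 0 * 0%N%:R); exists (fun=> 0%N) => //= i.
  by rewrite /usage big1.
move=> _ [d /= dA <-].
apply: (@le_trans _ _ (\sum_m (\sum_(i in ends G m) y i) * (d m)%:R)).
  by apply: ler_sum => m _; rewrite ler_wpM2r.
rewrite sum_usage; apply: ler_sum => i _.
by rewrite ler_wpM2l // ler_nat.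
Qed.

Lemma offline_reward_le (y : 'I_n -> R) t :
  (forall i, 0 <= y i) ->
  (forall m, rew G m 0 <= \sum_(i in ends G m) y i) ->
  offline_reward G t <= \sum_i y i * (t%:R * lam G i 0).
Proof.
move=> y0 yr; under [leRHS]eq_bigr do rewrite -sum_arrival_count mulr_sumr.
rewrite exchange_big; apply: ler_sum => a _.
apply: le_trans (ler_wpM2l _ (offline_value_le y _ y0 yr)) _.
  by apply: prodr_ge0 => u _; apply/ltW/lam_gt0.
by rewrite mulr_sumr; under eq_bigr do rewrite mulrCA.
Qed.

End Tuples.

(** * Dynamics of the probabilistic matching policy *)

Section PMDynamics.
Context {R : realType} {n K : nat} {G : network R n K}.
Context {z : 'cV[R]_K} {s : 'cV[R]_n} (hgpg : gpg G z s).
Context {zs : history n K -> 'cV[R]_K * 'cV[R]_n} (hzs : pm_solutions G z s zs).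
Implicit Types (h : history n K) (d : action K).

Local Notation tr := (surplus_types s).
Local Notation Q := (queue G tr).
Local Notation U := (pm_nonempty G s).
Local Notation mu i := (lam G i 0 + gap z s / n%:R).

Lemma pm_decide_support h j d : decide (PM hzs) h j d != 0 ->
  (d = no_action K /\ (forall i, i \in neighbors G z j -> i \notin U h)) \/
  exists i, [/\ i \in neighbors G z j, i \in U h & d = match_action G i j].
Proof.
rewrite /= /pm_decide; case: ifPn => [/eqP c0|_] dn0.
  left; split=> [|i ij].
    by apply/eqP; apply: contraNT dn0 => /negbTE ->.
  by apply: contraT => /negbNE iU; rewrite -(finset.in_set0 i) -c0 finset.inE ij.
right; have [i iP dE] : exists2 i, i \in neighbors G z j :&: U h &
    d = match_action G i j.
  apply/exists2P; apply/not_existsP => H; case/negP: dn0; apply/eqP/big1 => i iP.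
  by case: eqP => [dE|_]; [case: (H i) | rewrite mulr0].
by exists i; case/finset.setIP: iP.
Qed.

Lemma queue_rcons h e i : i \notin tr ->
  Q (rcons h e) i = (Q h i + (i == e.1) - usage G e.2 i)%N.
Proof. by move=> /negbTE itr; rewrite /queue foldl_rcons /queue_step itr. Qed.

Lemma queue_truncated h i : i \in tr -> Q h i = 0%N.
Proof.
move=> itr; case/lastP: h => // h e.
by rewrite /queue foldl_rcons /queue_step itr.
Qed.

Lemma mem_nonempty h i : (i \in U h) = (0 < Q h i)%N.
Proof. by rewrite inE. Qed.

Lemma nonempty_notin_truncated h i : i \in U h -> i \notin tr.
Proof.
by rewrite mem_nonempty; apply: contraTN => /queue_truncated ->.
Qed.

(** The perturbed program depends on the history through [U h] alone. *)
Lemma pm_solution_unique h h' : U h = U h' -> (zs h).1 = (zs h').1.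
Proof.
move=> UU; have [[f1 _] ss1] := hzs h; have [[f2 _] ss2] := hzs h'.
rewrite UU in f1; exact: (same_support_unique hgpg _ _ _ _ _ f1 ss1 f2 ss2).
Qed.

Definition independent_nonempty h :=
  forall i j, i \in U h -> j \in U h -> i \notin neighbors G z j.

Lemma at_match_neighbor h i j : j \notin neighbors G z i -> at_match G (zs h).1 i j = 0.
Proof.
move=> jN; have [[[_ z0 _] _] [sz _]] := hzs h.
have [[[_ zz0 _] _] _] := hgpg.
apply: big1 => m mij; apply/eqP; have := sz m; case: eqP => //= _ zm.
case/negP: jN; rewrite inE; apply/existsP; exists m.
by rewrite inE finset.setUC mij lt0r -zm zz0.
Qed.

Lemma sum_at_match_slack h i :
  \sum_j at_match G (zs h).1 i j + (zs h).2 i 0 =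
  lam G i 0 + (if i \in U h then gap z s / n%:R else 0).
Proof.
have [[[/colP/(_ i) e _ _] _] _] := hzs h.
by move: e; rewrite [LHS]mxE [RHS]mxE sum_at_match.
Qed.

(** A nonempty queue is not truncated, so its slack is zero in (z, s), hence in every solution with
    the same support. *)
Lemma sum_at_match_nonempty h i : i \in U h ->
  \sum_j at_match G (zs h).1 i j = mu i.
Proof.
move=> iU; have [_ [_ ss]] := hzs h.
have [[[_ _ s0] _] _] := hgpg.
have := sum_at_match_slack h i; rewrite iU => <-.
suff /eqP -> : (zs h).2 i 0 == 0 by rewrite addr0.
have := nonempty_notin_truncated h i iU; rewrite inE lt0r s0 andbT negbK.
by have := ss i; case: eqP; case: eqP.
Qed.

Lemma at_match_solution_ge0 h i j : 0 <= at_match G (zs h).1 i j.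
Proof. by have [[[_ z0 _] _] _] := hzs h; apply: sumr_ge0. Qed.

Lemma sum_at_match_empty h j : j \notin U h ->
  \sum_i at_match G (zs h).1 i j <= lam G j 0.
Proof.
move=> jU; have [[[_ _ s0] _] _] := hzs h.
under eq_bigr do rewrite at_matchC.
have := sum_at_match_slack h j; rewrite (negbTE jU) addr0 => <-.
by rewrite lerDl.
Qed.

Lemma at_match_le h i j : independent_nonempty h -> i \in U h ->
  at_match G (zs h).1 i j <= (j != i)%:R * lam G j 0.
Proof.
move=> ind iU; have [jN|jN] := boolP (j \in neighbors G z i); last first.
  by rewrite at_match_neighbor // mulr_ge0 // ltW ?lam_gt0.
have ji : j != i by apply: contraTneq jN => ->; apply: neighbors_irrefl.
rewrite ji mul1r; apply: le_trans (sum_at_match_empty h j _).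
  by rewrite (bigD1 i) //= lerDl sumr_ge0 // => k _; apply: at_match_solution_ge0.
by apply: contraTN jN => jU; apply: ind.
Qed.

(** A match makes no queue newly nonempty. An unmatched arrival can do so only for its own type, and
    then all its neighbors are empty. *)
Lemma independent_rcons h j d : independent_nonempty h ->
  decide (PM hzs) h j d != 0 -> independent_nonempty (rcons h (j, d)).
Proof.
move=> ind dn0 a b aU bU.
have qU k : k \in U (rcons h (j, d)) -> (usage G d k < Q h k + (k == j))%N.
  move=> kU; move: (kU); rewrite mem_nonempty queue_rcons ?subn_gt0 //.
  exact: nonempty_notin_truncated kU.
have [[dE Nj]|[i [iN iU dE]]] := pm_decide_support h j d dn0.
  have oldU k : k \in U (rcons h (j, d)) -> k != j -> k \in U h.
    by move=> /qU + /negbTE kj; rewrite dE usage_no_action kj addn0 mem_nonempty.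
  have [aj|aj] := eqVneq a j; have [bj|bj] := eqVneq b j.
  - by rewrite aj bj neighbors_irrefl.
  - by rewrite aj neighborsC; apply: contraTN (oldU b bU bj); apply: Nj.
  - by rewrite bj; apply: contraTN (oldU a aU aj); apply: Nj.
  - by apply: ind; apply: oldU.
have oldU k : k \in U (rcons h (j, d)) -> k \in U h.
  move=> /qU; rewrite dE (usage_match_action z) // !inE.
  by case: (k == j); rewrite ?orbT ?addn0 //=; lia.
by apply: ind; apply: oldU.
Qed.

(** Independence drives the drift estimates, conservation of agents converts rewards into queue
    lengths, and the last clause gives complementary slackness. *)
Definition pm_invariant h :=
  [/\ independent_nonempty h,
      forall i, i \notin tr -> (Q h i + usage G (performed h) i)%N = arrivals h i
    & forall m, z m 0 = 0 -> performed h m = 0%N].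

Lemma pm_invariant_nil : pm_invariant [::].
Proof.
split=> [i j|i _|m _]; first by rewrite mem_nonempty.
  by rewrite /usage big1 // => m _; rewrite /performed big_nil.
by rewrite /performed big_nil.
Qed.

Lemma pm_invariantP : stable (PM hzs) pm_invariant.
Proof.
move=> h j d [ind bal act] dn0; split; first exact: independent_rcons.
  move=> i itr; rewrite queue_rcons // /arrivals -[in RHS]cats1 count_cat /= addn0.
  have -> : usage G (performed (rcons h (j, d))) i =
      (usage G (performed h) i + usage G d i)%N.
    by rewrite -usageD; apply: eq_bigr => m _; rewrite performed_rcons.
  have := decide_feasible dn0 i; rewrite -/(arrivals h i) -bal //=.
  by rewrite (eq_sym i) => dle; rewrite (addnC (usage G (performed h) i)) addnA subnK // addnAC.
move=> m zm; rewrite performed_rcons act //= add0n.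
have [[-> _]|[i [iN _ ->]]] := pm_decide_support h j d dn0; first by rewrite ffunE.
rewrite ffunE; case: eqP => // mij; move: iN; rewrite inE => /existsP[m' /andP[]].
by rewrite inE -mij (inj_eq (@ends_inj _ _ _ G)) => + /eqP m'm; rewrite m'm zm ltxx.
Qed.

(** The normalizing sum W is at most lambda_j because the rate of an empty queue is not perturbed;
    hence lambda_j z~/W >= z~. *)
Lemma pm_decide_match_ge h i j : i \in neighbors G z j -> i \in U h -> j \notin U h ->
  at_match G (zs h).1 i j <= lam G j 0 * decide (PM hzs) h j (match_action G i j).
Proof.
move=> iN iU jU; rewrite /= /pm_decide.
have ic : i \in neighbors G z j :&: U h by rewrite inE iN.
case: ifPn => [/eqP c0|_]; first by rewrite c0 inE in ic.
set W := \sum_(k in neighbors G z j :&: U h) at_match G (zs h).1 k j; have W0 : 0 <= W.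
  by apply: sumr_ge0 => k _; apply: at_match_solution_ge0.
have WL : W <= lam G j 0.
  apply: le_trans (sum_at_match_empty h j jU).
  rewrite [leRHS](bigID (mem (neighbors G z j :&: U h))) /= lerDl.
  by apply: sumr_ge0 => k _; apply: at_match_solution_ge0.
(* If W is not positive, its summand for [i] is not positive either, and the right-hand side is
   nonnegative. *)
have [Wp|Wn] := ltP 0 W; last first.
  apply: (@le_trans _ _ W).
    by rewrite /W (bigD1 i) //= lerDl sumr_ge0 // => k _; apply: at_match_solution_ge0.
  apply: (le_trans Wn); apply: mulr_ge0; first exact/ltW/lam_gt0.
  apply: sumr_ge0 => k _; rewrite mulr_ge0 // divr_ge0 //.
  exact: at_match_solution_ge0.
apply: (@le_trans _ _ (lam G j 0 * (at_match G (zs h).1 i j / W))).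
  rewrite mulrCA -[leLHS]mulr1 ler_wpM2l ?at_match_solution_ge0 //.
  by rewrite ler_pdivlMr // mul1r.
apply: ler_wpM2l; first exact/ltW/lam_gt0.
rewrite (bigD1 i) //= eqxx mulr1 lerDl; apply: sumr_ge0 => k _.
by rewrite mulr_ge0 // divr_ge0 // at_match_solution_ge0.
Qed.

Lemma ler_sum_decide N h j d (f : action K -> R) : (forall d, 0 <= f d) ->
  (forall m, d m < N.+1)%N ->
  decide (PM hzs) h j d * f d <=
  \sum_(d' : {ffun 'I_K -> 'I_N.+1})
    decide (PM hzs) h j (action_of_ord d') * f (action_of_ord d').
Proof.
move=> f0 dN; pose e : {ffun 'I_K -> 'I_N.+1} := [ffun m => inord (d m)].
have eE : action_of_ord e = d by apply/ffunP => m; rewrite !ffunE /= inordK.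
rewrite (bigD1 e) //= eE lerDl; apply: sumr_ge0 => d' _.
by rewrite mulr_ge0 //; apply: pm_decide_ge0.
Qed.

(** By independence every neighbor of [i] has an empty queue, so its arrivals serve [i] at rate at
    least z~; these rates add up to mu_i. *)
Lemma departure_rate h i : independent_nonempty h -> i \in U h ->
  mu i <= expect (PM hzs) 1 (fun x => (Q x i < Q h i)%N%:R) h.
Proof.
move=> ind iU; rewrite -(sum_at_match_nonempty h i iU) /=.
have itr := nonempty_notin_truncated h i iU.
apply: ler_sum => j _.
have [jN|jN] := boolP (j \in neighbors G z i); last first.
  rewrite at_match_neighbor //; apply: mulr_ge0; first exact/ltW/lam_gt0.
  by apply: sumr_ge0 => d _; rewrite mulr_ge0 //; apply: pm_decide_ge0.
have iN : i \in neighbors G z j by rewrite neighborsC.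
have jU : j \notin U h by apply: contraTN jN => jU; apply: ind.
apply: le_trans (pm_decide_match_ge h i j iN iU jU) _.
apply: ler_wpM2l; first exact/ltW/lam_gt0.
have ij : (i == j) = false.
  by apply/negbTE; apply: contraTneq jN => ->; apply: neighbors_irrefl.
have down : (Q (rcons h (j, match_action G i j)) i < Q h i)%N.
  rewrite queue_rcons //= (usage_match_action z) // !inE eqxx ij /=.
  by move: iU; rewrite mem_nonempty; lia.
have := @ler_sum_decide (size h).+1 h j (match_action G i j)
  (fun d => (Q (rcons h (j, d)) i < Q h i)%N%:R).
rewrite down mulr1; apply=> [d|m]; first exact: ler0n.
by rewrite ffunE; case: eqP.
Qed.

(** A queue grows only when its own type arrives, and by at most one. *)
Lemma arrival_rate h k i : (Q h i < k)%N -> i \notin tr ->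
  expect (PM hzs) 1 (fun x => (k <= Q x i)%N%:R) h <= lam G i 0 * (k <= (Q h i).+1)%N%:R.
Proof.
move=> Qk itr; rewrite /= [leRHS](_ : _ = \sum_j lam G j 0 * ((j == i) && (k <= (Q h i).+1)%N)%:R);
  last first.
  by rewrite (bigD1 i) //= eqxx big1 ?addr0 // => j /negbTE ->; rewrite mulr0.
apply: ler_sum => j _; apply: ler_wpM2l; first exact/ltW/lam_gt0.
set b := leRHS; rewrite -[b]mul1r -[X in X * b](decide_sum1 (PM hzs) h j) mulr_suml.
apply: ler_sum => d _; apply: ler_wpM2l; first exact: pm_decide_ge0.
rewrite /b queue_rcons //= ler_nat (eq_sym i).
by case: (j == i); lia.
Qed.

(* In the state where i is the only waiting type, the departure rate mu_i of
   queue i is carried by arrivals of other types. *)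
Lemma rates_le1 i : i \notin tr -> lam G i 0 + mu i <= 1.
Proof.
move=> itr; pose h : history n K := [:: (i, no_action K)].
have Uh k : k \in U h -> k = i.
  move=> kU; move: (kU); rewrite mem_nonempty (queue_rcons [::]) //=.
    by case: (k =P i) => //; rewrite addn0.
  exact: nonempty_notin_truncated kU.
have ind : independent_nonempty h.
  by move=> a b /Uh -> /Uh ->; apply: neighbors_irrefl.
have iU : i \in U h.
  by rewrite mem_nonempty (queue_rcons [::]) //= eqxx usage_no_action.
rewrite -(sum_at_match_nonempty h i iU) -(lam_sum1 G) [leRHS](bigD1 i) //= lerD2l.
rewrite [leRHS]big_mkcond; apply: ler_sum => j _.
apply: le_trans (at_match_le h i j ind iU) _.
by case: ifP; rewrite ?mul1r ?mul0r.
Qed.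

Lemma pm_step h i k : pm_invariant h -> i \notin tr -> (0 < k)%N ->
  expect (PM hzs) 1 (fun x => (k <= Q x i)%N%:R) h <=
  (1 - lam G i 0 - mu i) * (k <= Q h i)%N%:R +
  (lam G i 0 * (k.-1 <= Q h i)%N%:R + mu i * (k.+1 <= Q h i)%N%:R).
Proof.
move=> hI itr k0; have [Qk|Qk|Qk] := ltngtP k (Q h i).
- rewrite [in leRHS]/nat_of_bool (_ : (k.-1 <= Q h i)%N); last by lia.
  rewrite !mulr1 [leRHS](_ : _ = 1); last by ring.
  by apply: expect_le_cst pm_invariantP hI _ => x _; rewrite lern1 leq_b1.
- apply: le_trans (arrival_rate h k i Qk itr) _.
  rewrite !mulr0 add0r addr0 (_ : (k <= (Q h i).+1)%N = (k.-1 <= Q h i)%N) //.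
  by lia.
(* At k = Q the right-hand side is 1 - mu_i: staying at level k and dropping below it are exclusive
   events. *)
have iU : i \in U h by rewrite mem_nonempty -Qk.
have [ind _ _] := hI.
rewrite (_ : (k.-1 <= Q h i)%N); last by lia.
rewrite mulr0 !mulr1 addr0 addrAC subrK lerBrDr.
apply: (le_trans (lerD (lexx _) (departure_rate h i ind iU))).
have := expect_linear (PM hzs) 1 1 (fun x => (k <= Q x i)%N%:R)
  (fun x => (Q x i < Q h i)%N%:R) h.
rewrite mul1r => <-; apply: expect_le_cst pm_invariantP hI _ => x _.
by rewrite mul1r -natrD lern1 Qk; case: leqP.
Qed.

Lemma pm_expected_queue t i : i \notin tr ->
  expect (PM hzs) t (fun x => (Q x i)%:R) [::] <= lam G i 0 * (n%:R / gap z s).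
Proof.
move=> itr; have n0 : (0 < n)%N by apply: leq_ltn_trans (ltn_ord i).
have g0 : 0 < gap z s / n%:R by rewrite divr_gt0 ?gap_gt0 // ltr0n.
have -> : lam G i 0 * (n%:R / gap z s) = lam G i 0 / (mu i - lam G i 0).
  by rewrite [mu i]addrC addrK invf_div.
apply: (expect_le_geometric _ pm_invariant) => //.
- exact: pm_invariantP.
- exact/ltW/lam_gt0.
- by rewrite ltrDl.
- exact: rates_le1.
- by move=> h k hI; apply: pm_step.
- move=> h [_ /(_ i itr) bal _].
  by apply: leq_trans (leq_addr (usage G (performed h) i) _) _; rewrite bal; apply: count_size.
- exact: pm_invariant_nil.
Qed.

(** Only active matches are performed, so the reward is the multiplier-weighted usage. Usage is
    arrivals minus queue for a non-truncated type, and a truncated type has multiplier 0. *)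
Lemma pm_reward_ge (y : 'I_n -> R) t :
  (forall i, 0 < s i 0 -> y i = 0) ->
  (forall m, 0 < z m 0 -> rew G m 0 = \sum_(i in ends G m) y i) ->
  \sum_i y i * (t%:R * lam G i 0) -
  \sum_i y i * expect (PM hzs) t (fun x => (Q x i)%:R) [::]
    <= policy_reward (PM hzs) t.
Proof.
move=> ys yz; have [[[_ z0 _] _] _] := hgpg.
have -> : \sum_i y i * (t%:R * lam G i 0) =
    expect (PM hzs) t (fun x => \sum_i y i * (arrivals x i)%:R) [::].
  by rewrite expect_sum; apply: eq_bigr => i _; rewrite expect_arrivals add0r.
rewrite -expect_sum addrC -mulN1r -expect_linear.
apply: ler_expect pm_invariantP pm_invariant_nil _ => x [_ bal act] _.
rewrite /collected [leRHS](_ : _ = \sum_m (\sum_(i in ends G m) y i) * (performed x m)%:R).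
  rewrite sum_usage mulN1r addrC -sumrB; apply: ler_sum => i _.
  have [itr|itr] := boolP (i \in tr); last by rewrite -bal // natrD mulrDr addrAC subrr add0r.
  by rewrite ys ?mul0r ?subr0 //; rewrite inE in itr.
apply: eq_bigr => m _; have [zm|zm] := ltP 0 (z m 0); first by rewrite yz.
by rewrite act ?mulr0 //; apply/eqP; rewrite eq_le zm z0.
Qed.

Lemma pm_regret_le T : regret (PM hzs) T <= rmax G z * (n%:R / gap z s).
Proof.
have [y [y0 ys yr yz]] := gpg_dual hgpg.
apply: ge_sup; first by exists (offline_reward G 0 - policy_reward (PM hzs) 0); exists 0%N.
move=> _ [t _ <-].
have := lerB (offline_reward_le y t y0 yr) (pm_reward_ge y t ys yz).
rewrite subKr => /le_trans; apply.
have : 0 <= n%:R / gap z s by rewrite divr_ge0 // ltW // gap_gt0.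
have := pm_expected_queue t; move: (_ / _) => c qc c0.
(* Since the rates sum to 1, the bound splits over types with weights lambda_i, so summing the
   queues costs no further factor n. *)
have -> : rmax G z * c = \sum_i rmax G z * (lam G i 0 * c).
  by rewrite -mulr_sumr -mulr_suml lam_sum1 mul1r.
apply: ler_sum => i _; have [itr|itr] := boolP (i \in tr).
  rewrite ys ?mul0r; last by rewrite inE in itr.
  by apply: mulr_ge0; [exact: rmax_ge0 | apply: mulr_ge0 => //; exact/ltW/lam_gt0].
apply: ler_pM => //; first 1 last.
- exact: (dual_le_rmax hgpg).
- exact: qc.
(* Nonnegativity of the expected queue, by comparison with the constant 0. *)
have := ler_expect (PM hzs) pm_invariant t (fun=> 0) (fun x => (Q x i)%:R) _
  pm_invariantP pm_invariant_nil.
by rewrite expect_cst; apply.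
Qed.

End PMDynamics.

Theorem mainTheorem1 (R : realType) :
  exists C : R, 0 < C /\
  forall (n K : nat) (G : network R n K) (z : 'cV[R]_K) (s : 'cV[R]_n)
    (hgpg : gpg G z s)
    (zs : history n K -> 'cV[R]_K * 'cV[R]_n) (hzs : pm_solutions G z s zs),
    (forall h h' : history n K,
       nonempty_queues G (truncated (PM hzs)) h =
       nonempty_queues G (truncated (PM hzs)) h' ->
       forall (j : 'I_n) (d : action K),
         decide (PM hzs) h j d = decide (PM hzs) h' j d) /\
    (forall T : nat, (1 <= T)%N ->
       regret (PM hzs) T <= C * rmax G z * (n%:R `^ (5 / 2) / gap z s)).
Proof.
(* The bound rmax n / eps already has constant 1, and n <= n^(5/2) once n >= 1. *)
exists 1; split=> // n K G z s hgpg zs hzs; split=> [h h' UU j d|T _].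
  by rewrite /= /pm_decide /pm_nonempty UU (pm_solution_unique hgpg hzs _ _ UU).
apply: le_trans (pm_regret_le hgpg hzs T) _; rewrite mul1r.
apply: ler_wpM2l; first exact: rmax_ge0.
apply: ler_wpM2r; first by rewrite invr_ge0 ltW // gap_gt0.
(* With no types, the rates could not sum to 1. *)
have n0 : (0 < n)%N.
  rewrite lt0n; apply/eqP => n0; have := lam_sum1 G; rewrite big1 => [/eqP|i _].
    by rewrite eq_sym oner_eq0.
  by exfalso; have := ltn_ord i; rewrite [X in (_ < X)%N]n0.
rewrite -[leLHS]powRr1 // ler_powR ?ler1n //; lra.
Qed.
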